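(* For any constant $0\leq s<2$ and any integer $k\geq 3$, Maker has a winning strategy in the bichromatic Maker-Breaker game with bias $1:s$.
   Context: Bichromatic Maker-Breaker game with bias $1:s$: Maker and Breaker alternately place points in the plane, Maker starting; per round Maker places one point and Breaker places $s$ points (for noninteger speeds, the multiset $\{i\cdot 1:i\in\mathbb{N}\}\cup\{i\cdot s:i\in\mathbb{N}\}$ is ordered increasingly, ties broken in favor of Maker, and this order determines whose turn it is). Let $M$ and $B$ be the sets of points placed by Maker and Breaker; $S=M\cup B$ must always be in general position (no three collinear). Maker wins if at some time there is a $k$-hole $H$ of $S$ with $H\subseteq M$; Breaker wins if she can prolong the game indefinitely without this happening. A $k$-hole of $S$ is a subset $H\subseteq S$ of size $k$ such that $\mathrm{conv}(H)$ is a convex $k$-gon and $\mathrm{conv}(H)\cap S=H$. *)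

(* Defs.v *)
From mathcomp Require Import all_boot all_order all_algebra finmap.
From mathcomp Require Import boolp classical_sets reals convex.

Set Implicit Arguments.
Unset Strict Implicit.
Unset Printing Implicit Defensive.

Import Order.TTheory GRing.Theory Num.Theory.
Local Open Scope ring_scope.

Notation plane R := 'rV[R]_2.

Section Geometry.
Variable R : realType.
Implicit Types (p q r : plane R) (S V H : {fset plane R}).

Definition collinear p q r : Prop :=
  exists a d : plane R, d != 0 /\
    forall x, x \in [:: p; q; r] -> exists t : R, x = a + t *: d.

Definition general_position S : Prop :=
  forall p q r, p \in S -> q \in S -> r \in S ->
    p != q -> q != r -> p != r -> ~ collinear p q r.

Definition conv_hull (A : set (plane R)) : set (plane R) :=
  smallest (@convex_set R (plane R)) A.

(* P is a convex k-gon: the hull of k points, each of which is a vertex,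
   i.e. is not in the hull of the remaining ones. *)
Definition convex_gon (k : nat) (P : set (plane R)) : Prop :=
  exists V,
    [/\ #|` V| = k,
        P = conv_hull [set` V]%classic
      & forall v, v \in V -> ~ conv_hull [set` (V `\ v)%fset]%classic v].

Definition hole (k : nat) S H : Prop :=
  [/\ (H `<=` S)%fset,
      #|` H| = k,
      convex_gon k (conv_hull [set` H]%classic)
    & (conv_hull [set` H] `&` [set` S] = [set` H])%classic].

End Geometry.

Section Game.
Variable R : realType.
Implicit Types (s : R) (h : seq (plane R)).

(* Turn order.  Maker's moves are labelled i * s and Breaker's moves i * 1,
   for i = 0, 1, 2, ..., and moves are made in increasing order of labels, ties
   being broken in favor of Maker.  Once Maker has moved m times and Breaker b
   times, the next labels are m * s and b, hence the merge below.  For a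
   positive integer s this is one Maker move, s Breaker moves, and so on. *)
Definition maker_next s (mb : nat * nat) : bool := mb.1%:R * s <= mb.2%:R.

Fixpoint move_counts s (n : nat) : nat * nat :=
  if n is n'.+1 then
    let mb := move_counts s n' in
    if maker_next s mb then (mb.1.+1, mb.2) else (mb.1, mb.2.+1)
  else (0%N, 0%N).

Definition maker_turn s (n : nat) : bool := maker_next s (move_counts s n).

(* A history is the sequence of all points placed so far, in order; the n-th
   one (from 0) is Maker's iff [maker_turn s n]. *)
Definition placed h : {fset plane R} := [fset p in h]%fset.

Definition maker_points s h : {fset plane R} :=
  [fset p in [seq h`_i | i <- iota 0 (size h) & maker_turn s i]]%fset.

Definition legal_move h (p : plane R) : Prop :=
  p \notin h /\ general_position (placed (rcons h p)).

Definition maker_has_won s (k : nat) h : Prop :=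
  exists H, hole k (placed h) H /\ (H `<=` maker_points s h)%fset.

Definition strategy : Type := seq (plane R) -> plane R.

(* In h, Maker has followed sigma and all of Breaker's moves were legal. *)
Definition consistent s (sigma : strategy) h : Prop :=
  forall i, (i < size h)%N ->
    if maker_turn s i then h`_i = sigma (take i h)
    else legal_move (take i h) h`_i.

Definition legal_strategy s (sigma : strategy) : Prop :=
  forall h, consistent s sigma h -> maker_turn s (size h) ->
    legal_move h (sigma h).

(* An infinite play is x : nat -> plane R, with x n the n-th point placed.
   Play is formally continued after a win: every position admits a legal move,
   since finitely many lines do not cover the plane, so this costs neither
   player anything and finite plays always extend to infinite ones. *)
Definition winning_strategy s (k : nat) (sigma : strategy) : Prop :=
  legal_strategy s sigma /\
  forall x : nat -> plane R,
    (forall n, consistent s sigma (mkseq x n)) ->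
    exists n, maker_has_won s k (mkseq x n).

End Game.

(* Main.v *)
Require Import Defs.
From mathcomp Require Import all_boot all_order all_algebra.
From mathcomp Require Import finmap boolp classical_sets reals convex interval_inference.
From mathcomp Require Import lra ring zify.

(* Maker's first point is the origin, and all her later points lie in the right half-plane.
   She keeps a family of j-holes of her own points that all contain the origin and
   occupy pairwise non-overlapping intervals of slopes, so that one point of Breaker destroys
   at most one of them.  Given two such j-holes separated by a gap, a point d placed
   close enough to the origin, in a direction inside the gap, extends both of them to
   (j+1)-holes; these share only the segment from the origin to d, so Breaker needs
   two points to destroy both.  As s < 2, a constant fraction of a large family of
   j-holes can thus be turned into a family of (j+1)-holes.  Starting from many copies
   of the 1-hole consisting of the origin, Maker reaches k after k - 1 stages. *)

Set Implicit Arguments.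
Unset Strict Implicit.
Unset Printing Implicit Defensive.

Import Order.TTheory GRing.Theory Num.Theory.
Local Open Scope ring_scope.

(** * Conditions that hold for all sufficiently small positive numbers *)

Section Small.
Variable R : realFieldType.

Definition small (P : R -> Prop) : Prop :=
  exists2 e0, 0 < e0 & forall e, 0 < e -> e < e0 -> P e.

Lemma smallT (P : R -> Prop) : (forall e, 0 < e -> P e) -> small P.
Proof. by move=> allP; exists 1 => // e e_gt0 _; apply: allP. Qed.

Lemma small_and (P Q : R -> Prop) :
  small P -> small Q -> small (fun e => P e /\ Q e).
Proof.
move=> [e1 e1_gt0 smallP] [e2 e2_gt0 smallQ].
exists (Num.min e1 e2); first by rewrite lt_min e1_gt0.
by move=> e e_gt0; rewrite lt_min => /andP[? ?]; split; [apply: smallP | apply: smallQ].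
Qed.

Lemma small_all (T : eqType) (s : seq T) (P : T -> R -> Prop) :
  {in s, forall x, small (P x)} -> small (fun e => {in s, forall x, P x e}).
Proof.
elim: s => [|x s IHs] smallP; first by apply: smallT => e _ x; rewrite in_nil.
have /small_and : small (P x) by apply: smallP; rewrite mem_head.
case/(_ _ (IHs _)) => [y ys|e0 e0_gt0 smallPs].
  by apply: smallP; rewrite inE ys orbT.
exists e0 => // e e_gt0 e_lt y; case: (smallPs e e_gt0 e_lt) => Px Ps.
by rewrite inE => /predU1P[->|/Ps].
Qed.

Lemma small_ex (P : R -> Prop) : small P -> exists2 e, 0 < e & P e.
Proof.
move=> [e0 e0_gt0 smallP]; exists (e0 / 2); first by rewrite divr_gt0.
by apply: smallP; rewrite ?divr_gt0 // ltr_pdivrMr // ltr_pMr // ltr1n.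
Qed.

Lemma small_impl (P Q : R -> Prop) :
  (forall e, 0 < e -> P e -> Q e) -> small P -> small Q.
Proof. by move=> PQ [e0 ? sP]; exists e0 => // e ? ?; apply: PQ => //; apply: sP. Qed.

Lemma small_lt (c M : R) : 0 < c -> small (fun e => e * M < c).
Proof.
move=> c_gt0; exists (c / (`|M| + 1)); first by rewrite divr_gt0 // ltr_wpDl.
move=> e e_gt0; rewrite ltr_pdivlMr ?ltr_wpDl // => lt_c.
apply: le_lt_trans lt_c; rewrite ler_pM2l //.
by apply: le_trans (ler_norm M) _; rewrite lerDl.
Qed.

Lemma small_neq (c M : R) : c != 0 -> small (fun e => c + e * M != 0).
Proof.
case: (ltgtP c 0) => // [c_lt0|c_gt0] _.
  have /(small_lt M) : 0 < - c by rewrite oppr_gt0.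
  by apply: small_impl => e _ lt_c; apply/eqP; lra.
have /(small_lt (- M)) := c_gt0.
by apply: small_impl => e _ lt_c; apply/eqP; rewrite mulrN in lt_c; lra.
Qed.

(** Each element of [s] equals [a + e] for at most one [e], so every sufficiently small positive [e]
    avoids the whole list. *)
Lemma itv_avoid (a b : R) (s : seq R) :
  a < b -> exists2 t, a < t < b & t \notin s.
Proof.
move=> lt_ab.
have small_ab : small (fun e => e * 1 < b - a).
  by apply: small_lt; rewrite subr_gt0.
have /small_all small_s : {in s, forall x, small (fun e => a + e != x)}.
  move=> x _; have [->|ne_ax] := eqVneq a x.
    by apply: smallT => e e_gt0; rewrite -subr_eq0 addrC addKr gt_eqF.
  have /(small_neq 1) : a - x != 0 by rewrite subr_eq0.
  by apply: small_impl => e _; rewrite mulr1 addrAC subr_eq0.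
have /small_ex [e e_gt0 [lt_ab_e ne_s]] := small_and small_ab small_s.
exists (a + e); first by apply/andP; split; lra.
by apply/negP => /ne_s; rewrite eqxx.
Qed.

End Small.

(** * Coordinates, orientation and general position in the plane *)

Section Geometry.
Variable R : realType.
Implicit Types (p q r v : plane R) (S H : {fset plane R}).

Definition xc p : R := p 0 0.
Definition yc p : R := p 0 1.

Definition pt (x y : R) : plane R := \row_i (if i == 0 then x else y).

Lemma xc_pt x y : xc (pt x y) = x. Proof. by rewrite /xc mxE. Qed.
Lemma yc_pt x y : yc (pt x y) = y. Proof. by rewrite /yc mxE. Qed.

Lemma plane_eq p q : xc p = xc q -> yc p = yc q -> p = q.
Proof.
move=> eq_x eq_y; apply/rowP => i.
have [->|->] // : i = 0 \/ i = 1.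
by case: i => [[|[|//]] lti]; [left | right]; apply: val_inj.
Qed.

Lemma xc0 : xc 0 = 0. Proof. by rewrite /xc mxE. Qed.
Lemma yc0 : yc 0 = 0. Proof. by rewrite /yc mxE. Qed.

Definition cross p q r : R :=
  (xc q - xc p) * (yc r - yc p) - (yc q - yc p) * (xc r - xc p).

Lemma cross_collinear p q r : p != q -> cross p q r = 0 -> collinear p q r.
Proof.
move=> ne_pq cross0; exists p, (q - p); split; first by rewrite subr_eq0 eq_sym.
suff [t def_r] : exists t, r = p + t *: (q - p).
  move=> x; rewrite !inE => /or3P[] /eqP->; last by exists t.
    by exists 0; rewrite scale0r addr0.
  by exists 1; rewrite scale1r addrC subrK.
have xcE t : xc (p + t *: (q - p)) = xc p + t * (xc q - xc p).
  by rewrite /xc !mxE.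
have ycE t : yc (p + t *: (q - p)) = yc p + t * (yc q - yc p).
  by rewrite /yc !mxE.
rewrite /cross in cross0.
have [eq_x|ne_x] := eqVneq (xc q - xc p) 0.
  have ne_y : yc q - yc p != 0.
    apply: contra ne_pq; rewrite subr_eq0 => /eqP eq_y.
    by apply/eqP; apply: plane_eq; [move/eqP: eq_x; rewrite subr_eq0 => /eqP-> | rewrite eq_y].
  exists ((yc r - yc p) / (yc q - yc p)); apply: plane_eq; rewrite ?xcE ?ycE.
    rewrite eq_x mul0r sub0r in cross0.
    have /eqP := cross0; rewrite oppr_eq0 mulf_eq0 (negPf ne_y) /= subr_eq0 => /eqP->.
    by rewrite eq_x mulr0 addr0.
  by rewrite divfK // addrC subrK.
exists ((xc r - xc p) / (xc q - xc p)); apply: plane_eq; rewrite ?xcE ?ycE.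
  by rewrite divfK // addrC subrK.
apply: (mulfI ne_x); rewrite mulrDr mulrCA mulrA divfK //.
by apply/eqP; rewrite -subr_eq0 -cross0; apply/eqP; ring.
Qed.

Lemma collinear_cross p q r : collinear p q r -> cross p q r = 0.
Proof.
case=> a [d [_ on_line]].
have [|t ->] := on_line p; first by rewrite mem_head.
have [|u ->] := on_line q; first by rewrite !inE eqxx orbT.
have [|w ->] := on_line r; first by rewrite !inE eqxx !orbT.
by rewrite /cross /xc /yc !mxE; ring.
Qed.

Lemma general_positionP S :
  general_position S <->
  {in S & &, forall p q r, p != q -> q != r -> p != r -> cross p q r != 0}.
Proof.
split=> gpS p q r pS qS rS ne_pq ne_qr ne_pr.
  by apply/negP => /eqP /(cross_collinear ne_pq); apply: gpS.
by move=> /collinear_cross /eqP; apply/negP; apply: gpS.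
Qed.

Lemma general_position_add S p :
  general_position S ->
  {in S &, forall q r, q != r -> cross q r p != 0} ->
  general_position (p |` S)%fset.
Proof.
move=> /general_positionP gpS gp_p; apply/general_positionP => a b c.
rewrite !in_fset1U => /predU1P[->|aS] /predU1P[->|bS] /predU1P[->|cS];
  rewrite ?eqxx // => ne_ab ne_bc ne_ac.
- by move: (gp_p b c bS cS ne_bc); rewrite /cross; apply: contraNneq => <-; apply/eqP; ring.
- by move: (gp_p a c aS cS ne_ac); rewrite -oppr_eq0 /cross;
  apply: contraNneq => <-; apply/eqP; ring.
- exact: gp_p.
- exact: gpS.
Qed.

(** The slope [t] avoids all directions from [v] to other points of [S]. Along the ray from [v] of
    slope [t], [cross q r] is affine in [e]: its constant term is nonzero if [q] and [r] differ from
    [v], and its linear term is nonzero if one of them is [v]. So it does not vanish for small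
    positive [e]. *)
Lemma general_position_near S v (a b : R) :
  v \in S -> general_position S -> a < b ->
  exists2 t, a < t < b &
    small (fun e => let d := pt (xc v + e) (yc v + e * t) in
      d \notin S /\ general_position (d |` S)%fset).
Proof.
move=> vS /[dup] gpS /general_positionP crossS lt_ab.
(* For [v] itself and for vertical directions the quotient by 0 is 0, which merely excludes one more
   slope. *)
have [t lt_t t_avoid] :=
  itv_avoid [seq (yc q - yc v) / (xc q - xc v) | q <- S] lt_ab.
have t_gen q : q \in S -> q != v -> (xc q - xc v) * t - (yc q - yc v) != 0.
  move=> qS ne_qv; apply: contra t_avoid => /eqP eq0.
  have [eq_x|ne_x] := eqVneq (xc q - xc v) 0.
    case/eqP: ne_qv; apply: plane_eq; apply/eqP; rewrite -subr_eq0 ?eq_x //.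
    by rewrite -oppr_eq0 -eq0 eq_x mul0r sub0r.
  apply/mapP; exists q => //; apply: (mulfI ne_x); rewrite mulrCA divff //.
  by rewrite mulr1; apply/eqP; rewrite -subr_eq0 eq0.
exists t => //.
have cross_small : small (fun e => {in S, forall q, {in S, forall r,
    q != r -> cross q r (pt (xc v + e) (yc v + e * t)) != 0}}).
  apply: small_all => q qS; apply: small_all => r rS.
  have [->|ne_qr] := eqVneq q r; first exact: smallT.
  have crossE e : cross q r (pt (xc v + e) (yc v + e * t)) =
      cross q r v + e * ((xc r - xc q) * t - (yc r - yc q)).
    by rewrite /cross xc_pt yc_pt; ring.
  have [eq_qv|ne_qv] := eqVneq q v.
    apply: smallT => e e_gt0 _; rewrite crossE eq_qv /cross !subrr !mulr0 subrr add0r.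
    by apply: mulf_neq0; [apply: lt0r_neq0 | apply: t_gen; rewrite // -eq_qv eq_sym].
  have [eq_rv|ne_rv] := eqVneq r v.
    apply: smallT => e e_gt0 _; rewrite crossE eq_rv.
    rewrite (_ : _ + _ = - (e * ((xc q - xc v) * t - (yc q - yc v)))); last first.
      by rewrite /cross; ring.
    by rewrite oppr_eq0; apply: mulf_neq0; [apply: lt0r_neq0 | apply: t_gen].
  apply: small_impl (small_neq _ (crossS _ _ _ qS rS vS ne_qr ne_rv ne_qv)).
  by move=> e _ ne0 _; rewrite crossE; exact: ne0.
apply: small_impl cross_small => e e_gt0 /= cross_e.
split; last by apply: general_position_add => // q r qS rS; apply: cross_e.
(* If the new point [d] were in [S], [cross_e] would apply to [v] and [d], although [cross v d d] is
   zero. *)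
apply/negP => dS; have [eq_dv|ne_dv] := eqVneq (pt (xc v + e) (yc v + e * t)) v.
  have := congr1 xc eq_dv; rewrite xc_pt => /eqP.
  by rewrite -subr_eq0 addrC addKr gt_eqF.
have /eqP[] : cross v (pt (xc v + e) (yc v + e * t)) (pt (xc v + e) (yc v + e * t)) != 0.
  by apply: cross_e => //; rewrite eq_sym.
by rewrite /cross; ring.
Qed.

(** * Strict linear separation, and sectors at the origin *)

Definition separated H p : Prop :=
  exists a b, {in H, forall h, h != p -> a * xc h + b * yc h < a * xc p + b * yc p}.

Lemma conv_hull_lt (A : set (plane R)) (a b c : R) x :
  (forall h, A h -> a * xc h + b * yc h < c) ->
  conv_hull A x -> a * xc x + b * yc x < c.
Proof.
move=> ltA /(_ [set y : plane R | a * xc y + b * yc y < c]%classic); apply; split; last first.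
  by move=> h /ltA.
move=> /= y z l; rewrite !inE /= => lt_y lt_z.
change (a * xc (l%:inum *: y + (1 - l%:inum) *: z) +
  b * yc (l%:inum *: y + (1 - l%:inum) *: z) < c).
have -> : a * xc (l%:inum *: y + (1 - l%:inum) *: z) +
    b * yc (l%:inum *: y + (1 - l%:inum) *: z) =
    l%:inum * (a * xc y + b * yc y) + (1 - l%:inum) * (a * xc z + b * yc z).
  by rewrite /xc /yc !mxE; ring.
have [l0 l1] : 0 <= l%:inum /\ l%:inum <= 1 by split; [apply: ge0 | apply: le1].
have [->|l_ne0] := eqVneq l%:inum 0; first by rewrite mul0r add0r subr0 mul1r.
have l_gt0 : 0 < l%:inum by rewrite lt_neqAle eq_sym l_ne0.
by nra.
Qed.

(** A separating functional makes a point of [H] a vertex of the hull, and keeps any other point of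
    [S] out of the hull. One condition thus gives both convex position and emptiness. *)
Lemma separated_hole k S H :
  (H `<=` S)%fset -> #|` H| = k -> {in S, forall p, separated H p} -> hole k S H.
Proof.
move=> /[dup] subHS /fsubsetP HS cardH sepH; split=> //.
  exists H; split=> // v vH.
  have [a [b sep_v]] := sepH v (HS v vH) => /conv_hull_lt hull_v.
  suff /hull_v : forall h, [set` (H `\ v)%fset]%classic h ->
      a * xc h + b * yc h < a * xc v + b * yc v by rewrite ltxx.
  by move=> h /=; rewrite in_fsetD1 => /andP[hv hH]; apply: sep_v.
apply/seteqP; split=> p /=; last first.
  by move=> pH; split; [by move=> K [_]; apply | apply: HS].
case=> hull_p pS; apply: contrapT => /negP pH.
have [a [b sep_p]] := sepH p pS.
suff : a * xc p + b * yc p < a * xc p + b * yc p by rewrite ltxx.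
apply: conv_hull_lt hull_p => h /= hH; apply: sep_p => //.
by apply: contraNneq pH => <-.
Qed.

Definition sector (lo hi : R) H : Prop :=
  {in H, forall h, h != 0 -> [/\ 0 < xc h, lo * xc h <= yc h & yc h <= hi * xc h]}.

Definition strictly_inside (lo hi : R) p : bool :=
  [&& 0 < xc p, lo * xc p < yc p & yc p < hi * xc p].

Lemma sector_le lo hi H h :
  sector lo hi H -> h \in H ->
  [/\ 0 <= xc h, lo * xc h <= yc h & yc h <= hi * xc h].
Proof.
move=> secH hH; have [->|/(secH _ hH)[/ltW]//] := eqVneq h 0.
by rewrite xc0 yc0 !mulr0.
Qed.

(** Left of the vertical axis, a vertical line separates [p]; on the axis, a line of slope [lo] or
    [hi] does. Otherwise the line through the origin and [p] has [H] weakly on one side, and general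
    position allows a slight tilt of it to separate strictly. *)
Lemma separated_outside lo hi H p :
  lo < hi -> sector lo hi H -> p != 0 ->
  {in H, forall h, h != 0 -> h != p -> cross 0 h p != 0} ->
  ~~ strictly_inside lo hi p -> separated H p.
Proof.
move=> lt_lohi secH p_ne0 gp_p outside.
have secH' h := sector_le secH (h := h).
have [x_lt0|x_gt0|x_eq0] := ltgtP (xc p) 0.
- exists (-1), 0 => h /secH'[x_ge0 _ _] _; lra.
- move: outside; rewrite /strictly_inside x_gt0 /= negb_and -!leNgt.
  have gp_p' h : h \in H -> h != 0 -> h != p -> xc h * yc p != yc h * xc p.
    move=> hH h0 hp; move: (gp_p h hH h0 hp).
    by rewrite /cross xc0 yc0 !subr0 subr_eq0.
  case/orP=> [y_le|y_ge].
    (* The functional [yc p * x - xc p * y] vanishes at [p] and at the origin and is negative at the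
       other points of [H]. The extra term [e * xc p * x] makes it positive at [p], and a small [e]
       keeps it negative at those other points. *)
    have small_h : small (fun e => {in H, forall h, h != 0 -> h != p ->
        e * (xc h * xc p) < yc h * xc p - xc h * yc p}).
      apply: small_all => h hH; have [->|h0] := eqVneq h 0; first exact: smallT.
      have [->|hp] := eqVneq h p; first exact: smallT.
      have lt_h : 0 < yc h * xc p - xc h * yc p.
        rewrite subr_gt0 lt_neqAle gp_p' //=.
        have [xh_gt0 le_h _] := secH h hH h0; nra.
      by apply: small_impl (small_lt (xc h * xc p) lt_h) => e _ lt_e _ _.
    have [e e_gt0 e_small] := small_ex small_h.
    have e_x : 0 < e * (xc p * xc p) by rewrite !mulr_gt0.
    exists (yc p + e * xc p), (- xc p) => h hH hp.
    have [->|h0] := eqVneq h 0; first by rewrite xc0 yc0; nra.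
    have := e_small h hH h0 hp; nra.
  have small_h : small (fun e => {in H, forall h, h != 0 -> h != p ->
      e * (xc h * xc p) < xc h * yc p - yc h * xc p}).
    apply: small_all => h hH; have [->|h0] := eqVneq h 0; first exact: smallT.
    have [->|hp] := eqVneq h p; first exact: smallT.
    have lt_h : 0 < xc h * yc p - yc h * xc p.
      rewrite subr_gt0 lt_neqAle eq_sym gp_p' //=.
      have [xh_gt0 _ le_h] := secH h hH h0; nra.
    by apply: small_impl (small_lt (xc h * xc p) lt_h) => e _ lt_e _ _.
  have [e e_gt0 e_small] := small_ex small_h.
  have e_x : 0 < e * (xc p * xc p) by rewrite !mulr_gt0.
  exists (e * xc p - yc p), (xc p) => h hH hp.
  have [->|h0] := eqVneq h 0; first by rewrite xc0 yc0; nra.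
  have := e_small h hH h0 hp; nra.
- have [y_lt0|y_gt0|y_eq0] := ltgtP (yc p) 0.
  + exists lo, (-1) => h /secH'[x_ge0 le_h _] _; rewrite x_eq0; lra.
  + exists (- hi), 1 => h /secH'[x_ge0 _ le_h] _; rewrite x_eq0; lra.
  + by case/eqP: p_ne0; apply: plane_eq; rewrite ?xc0 ?yc0.
Qed.

Lemma separated_origin lo hi H : sector lo hi H -> separated H 0.
Proof.
move=> secH; exists (-1), 0 => h hH h0.
by have [x_gt0 _ _] := secH h hH h0; rewrite xc0 yc0; lra.
Qed.

(* The new point is close to the origin, which already belongs to H, so the strict
   separations persist. *)
Lemma separated_add_near lo hi S H (t : R) :
  sector lo hi H -> 0 \in H -> {in S, forall p, separated H p} ->
  small (fun e => {in S, forall p, p != 0 -> separated (pt e (e * t) |` H)%fset p}).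
Proof.
move=> secH H0 sepH; apply: small_all => p pS.
have [->|p0] := eqVneq p 0; first exact: smallT.
have [a [b sep_p]] := sepH p pS.
have := sep_p 0 H0; rewrite eq_sym xc0 yc0 !mulr0 addr0 => /(_ p0) val_gt0.
apply: small_impl (small_lt (a + b * t) val_gt0) => e _ lt_e _.
exists a, b => h; rewrite in_fset1U => /predU1P[-> _|]; last exact: sep_p.
by rewrite xc_pt yc_pt; lra.
Qed.

(** The line of slope [hi] through the origin bounds the sector, and the new point lies strictly
    above it. *)
Lemma separated_new_above lo hi H (e t : R) :
  sector lo hi H -> hi < t -> 0 < e -> separated (pt e (e * t) |` H)%fset (pt e (e * t)).
Proof.
move=> secH lt_t e_gt0; exists (- hi), 1 => h.
rewrite in_fset1U => /predU1P[->|hH _]; first by rewrite eqxx.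
by have [x_ge0 _ le_h] := sector_le secH hH; rewrite xc_pt yc_pt; nra.
Qed.

Lemma separated_new_below lo hi H (e t : R) :
  sector lo hi H -> t < lo -> 0 < e -> separated (pt e (e * t) |` H)%fset (pt e (e * t)).
Proof.
move=> secH lt_t e_gt0; exists lo, (-1) => h.
rewrite in_fset1U => /predU1P[->|hH _]; first by rewrite eqxx.
by have [x_ge0 le_h _] := sector_le secH hH; rewrite xc_pt yc_pt; nra.
Qed.

Lemma sector_add lo hi lo' hi' H (e t : R) :
  sector lo hi H -> lo' <= lo -> hi <= hi' -> lo' <= t -> t <= hi' -> 0 < e ->
  sector lo' hi' (pt e (e * t) |` H)%fset.
Proof.
move=> secH le_lo le_hi le_t t_le e_gt0 h.
rewrite in_fset1U => /predU1P[-> _|hH h0].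
  by rewrite xc_pt yc_pt; split; nra.
by have [x_gt0 ? ?] := secH h hH h0; split=> //; nra.
Qed.

End Geometry.

(** * Cells with ordered slope intervals, and how a new point affects them *)

Section Cells.
Variable R : realType.
Implicit Types (p : plane R) (S M H : {fset plane R}).

(* A cell [(H, (lo, hi))] is a set H containing the origin, with its other points in the
   right half-plane at slopes from lo to hi; it is a hole when it is separated from S. *)
Definition cell : Type := {fset plane R} * (R * R).
Implicit Types (c : cell) (cs : seq cell).

(** The interval is nondegenerate even if [c.1] contains only the origin: it then reserves a range
    of slopes for later points. *)
Record good_cell S M (j : nat) c : Prop := GoodCell {
  cell_sub : (c.1 `<=` M)%fset;
  cell_card : #|` c.1| = j;
  cell_origin : 0 \in c.1;
  cell_lt : c.2.1 < c.2.2;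
  cell_sector : sector c.2.1 c.2.2 c.1;
  cell_separated : {in S, forall p, separated c.1 p} }.

(** Equality is allowed because the two cells created by one Maker move share the slope of the new
    point. *)
Definition before c c' : bool := c.2.2 <= c'.2.1.

Definition hit p c : bool := strictly_inside c.2.1 c.2.2 p.

Lemma count_hit p cs :
  {in cs, forall c, c.2.1 < c.2.2} -> pairwise before cs -> (count (hit p) cs <= 1)%N.
Proof.
elim: cs => //= c cs IHcs lt_cs /andP[/allP c_before pw_cs].
have lt_cs' : {in cs, forall c, c.2.1 < c.2.2}.
  by move=> d d_cs; apply: lt_cs; rewrite inE d_cs orbT.
have [/and3P[x_gt0 _ lt_hi]|_] /= := boolP (hit p c); last exact: IHcs.
suff -> : count (hit p) cs = 0%N by [].
apply/eqP; rewrite -leqn0 leqNgt -has_count; apply/hasPn => d d_cs.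
apply/negP => /and3P[_ lt_lo _]; have := c_before d d_cs; rewrite /before; nra.
Qed.

(** Old separations persist, so only [p] needs one. Since [p] is outside the open sector,
    [separated_outside] provides it, using general position of [p] with the origin. *)
Lemma good_cell_keep S M M' j c p :
  good_cell S M j c -> (M `<=` M')%fset -> (M `<=` S)%fset -> p \notin S ->
  general_position (p |` S)%fset -> ~~ hit p c -> good_cell (p |` S)%fset M' j c.
Proof.
case=> subM cardc c0 lt_c sec_c sep_c subMM' /fsubsetP subMS pS /general_positionP gpS not_hit.
have cS h : h \in c.1 -> h \in S by move=> hc; apply/subMS/(fsubsetP subM).
split=> //; first exact: fsubset_trans subMM'.
move=> q; rewrite in_fset1U => /predU1P[->|/sep_c //].
have p0 : p != 0 by apply: contraNneq pS => ->; apply: cS.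
apply: (separated_outside lt_c sec_c p0) => // h hc h0 hp.
by apply: gpS; rewrite // ?fset1U1 ?in_fset1U ?(cS _ hc) ?(cS _ c0) ?orbT // eq_sym.
Qed.

(** The slope [t] of the new point becomes one end of the interval. The new point is separated by
    the facing side of the old sector and the origin by a vertical line; the other points are
    covered by the last hypothesis. *)
Lemma good_cell_add S M j c (lo hi e t : R) :
  good_cell S M j c -> pt e (e * t) \notin M -> lo < hi -> 0 < e ->
  (lo = c.2.1 /\ hi = t /\ c.2.2 < t) \/ (lo = t /\ hi = c.2.2 /\ t < c.2.1) ->
  {in S, forall p, p != 0 -> separated (pt e (e * t) |` c.1)%fset p} ->
  good_cell (pt e (e * t) |` S)%fset (pt e (e * t) |` M)%fset j.+1
    ((pt e (e * t) |` c.1)%fset, (lo, hi)).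
Proof.
case=> subM cardc c0 lt_c sec_c sep_c dM lt_lohi e_gt0 bounds sep_d.
have sec_d : sector lo hi (pt e (e * t) |` c.1)%fset.
  by case: bounds => [[-> [-> lt_t]]|[-> [-> lt_t]]];
    apply: (sector_add sec_c) => //; lra.
split=> //=.
- exact: fsetUS.
- rewrite cardfsU1 cardc (_ : _ \notin _) //.
  by apply: contra dM => /(fsubsetP subM).
- by rewrite in_fset1U c0 orbT.
move=> p; rewrite in_fset1U => /predU1P[->|pS].
  case: bounds => [[_ [_ lt_t]]|[_ [_ lt_t]]].
    exact: separated_new_above sec_c lt_t e_gt0.
  exact: separated_new_below sec_c lt_t e_gt0.
by have [->|p0] := eqVneq p 0; [apply: separated_origin sec_d | apply: sep_d].
Qed.

End Cells.

(** * Bounds on the order of turns *)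

Section Turns.
Variables (R : realType) (s : R).
Hypotheses (s_ge0 : 0 <= s) (s_lt2 : s < 2).

(** The label of Breaker's next move minus the label of Maker's next move. *)
Definition lead n : R := (move_counts s n).2%:R - (move_counts s n).1%:R * s.

Lemma move_counts_add n : ((move_counts s n).1 + (move_counts s n).2)%N = n.
Proof. by elim: n => //= n IHn; case: ifP => _ /=; rewrite ?addSn ?addnS IHn. Qed.

Lemma maker_turnE n : maker_turn s n = (0 <= lead n).
Proof. by rewrite /maker_turn /maker_next subr_ge0. Qed.

Lemma move_counts_maker n : maker_turn s n ->
  (move_counts s n.+1).1 = (move_counts s n).1.+1 /\ lead n.+1 = lead n - s.
Proof.
rewrite /lead /maker_turn /= => ->; split=> //=.
by rewrite -natr1; ring.
Qed.

Lemma move_counts_breaker n : ~~ maker_turn s n ->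
  (move_counts s n.+1).1 = (move_counts s n).1 /\ lead n.+1 = lead n + 1.
Proof.
rewrite /lead /maker_turn /= => /negPf->; split=> //=.
by rewrite -natr1; ring.
Qed.

(** Maker moves only from a nonnegative value and lowers it by [s]; Breaker moves only from a
    negative value and raises it by 1. *)
Lemma lead_bounds n : - s <= lead n <= 1.
Proof.
elim: n => [|n /andP[IHn1 IHn2]]; first by rewrite /lead /= mul0r subr0 oppr_le0 s_ge0 ler01.
have [turn|turn] := boolP (maker_turn s n).
  have [_ ->] := move_counts_maker turn; move: turn; rewrite maker_turnE => lead_ge0.
  by rewrite -[leLHS]add0r lerD2r lead_ge0 (le_trans _ IHn2) // gerBl.
have [_ ->] := move_counts_breaker turn; move: turn; rewrite maker_turnE -ltNge => lead_lt0.
by rewrite (le_trans IHn1) ?lerDl //= -lerBrDr subrr ltW.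
Qed.

(** As [lead] is at most 1 and [s < 2], Breaker has made at most [2 * m + 1] moves when Maker has
    made [m]. This ensures that each stage ends. *)
Lemma moves_le n : (n <= 3 * (move_counts s n).1 + 1)%N.
Proof.
rewrite -{1}(move_counts_add n) mulSn -addnA leq_add2l -(ler_nat R) natrD natrM.
have /andP[_] := lead_bounds n; rewrite /lead.
have : 0 <= (move_counts s n).1%:R :> R by [].
by move: s_lt2; nra.
Qed.

End Turns.

(** * Effect of single moves on the families of cells *)

Section Game.
Variables (R : realType) (s : R) (k : nat).
Hypotheses (s_ge0 : 0 <= s) (s_lt2 : s < 2).
Implicit Types (h : seq (plane R)) (p : plane R) (L Q : seq (cell R)).

Lemma mem_placed h p : (p \in placed h) = (p \in h).
Proof. by rewrite inE. Qed.

Lemma placed_rcons h p : placed (rcons h p) = (p |` placed h)%fset.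
Proof. by apply/fsetP => q; rewrite in_fset1U !inE mem_rcons inE. Qed.

Lemma maker_points_rcons h p :
  maker_points s (rcons h p) =
  if maker_turn s (size h) then (p |` maker_points s h)%fset else maker_points s h.
Proof.
have eq_old : [seq (rcons h p)`_i | i <- iota 0 (size h) & maker_turn s i] =
    [seq h`_i | i <- iota 0 (size h) & maker_turn s i].
  apply/eq_in_map => i; rewrite mem_filter mem_iota add0n /= => /andP[_ lt_i].
  by rewrite nth_rcons lt_i.
apply/fsetP => q; rewrite /maker_points size_rcons.
rewrite -[(size h).+1]addn1 iotaD filter_cat map_cat eq_old /=.
case: ifP => _; rewrite ?cats0 //= nth_rcons ltnn eqxx.
by rewrite in_fset1U !inE orbF orbC.
Qed.

Lemma maker_points_sub h : (maker_points s h `<=` placed h)%fset.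
Proof.
apply/fsubsetP => q; rewrite !inE => /mapP[i].
rewrite mem_filter mem_iota add0n => /andP[_ /= lt_i] ->.
exact: mem_nth.
Qed.

Lemma legal_move_exists h : general_position (placed h) -> exists p, legal_move h p.
Proof.
case: h => [|v h] gp_h.
  by exists 0; split=> // p q r; rewrite !inE !orbF => /eqP-> /eqP->; rewrite eqxx.
have v_in : v \in placed (v :: h) by rewrite mem_placed mem_head.
have [t _ /small_ex[e _ [d_new gp_d]]] := general_position_near v_in gp_h ltr01.
exists (pt (xc v + e) (yc v + e * t)); split; last by rewrite placed_rcons.
by rewrite -mem_placed.
Qed.

(* While Maker turns j-holes into (j+1)-holes, L lists the (j+1)-holes obtained and Q,
   to the right of L, the j-holes not yet processed. *)
Record state (j : nat) h L Q : Prop := State {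
  state_origin : 0 \in maker_points s h;
  state_gp : general_position (placed h);
  state_new : {in L, forall c, good_cell (placed h) (maker_points s h) j.+1 c};
  state_old : {in Q, forall c, good_cell (placed h) (maker_points s h) j c};
  state_sorted : pairwise (@before R) (L ++ Q) }.

(** The cells hit by [p] are dropped; by [count_hit] on [L ++ Q] there is at most one. *)
Lemma breaker_step j h L Q p :
  state j h L Q -> legal_move h p ->
  exists L' Q', [/\ state j (rcons h p) L' Q', (size L' <= size L)%N,
    (size Q' <= size Q)%N & (size L + size Q <= (size L' + size Q').+1)%N].
Proof.
case=> origin gp_h good_L good_Q sorted_LQ [p_new gp_p].
rewrite placed_rcons in gp_p.
have p_new' : p \notin placed h by rewrite mem_placed.
have subM : (maker_points s h `<=` maker_points s (rcons h p))%fset.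
  by rewrite maker_points_rcons; case: ifP => _; rewrite ?fsubsetU1 ?fsubset_refl.
exists (filter (predC (hit p)) L), (filter (predC (hit p)) Q); split.
- split; rewrite ?placed_rcons //.
  + exact: (fsubsetP subM).
  + move=> c; rewrite mem_filter => /andP[not_hit /good_L gc].
    exact: good_cell_keep gc subM (maker_points_sub h) p_new' gp_p not_hit.
  + move=> c; rewrite mem_filter => /andP[not_hit /good_Q gc].
    exact: good_cell_keep gc subM (maker_points_sub h) p_new' gp_p not_hit.
  + by rewrite -filter_cat; apply: pairwise_filter.
- by rewrite size_filter count_size.
- by rewrite size_filter count_size.
rewrite -!size_cat -filter_cat size_filter -(count_predC (hit p)) -add1n leq_add2r.
apply: count_hit => // c; rewrite mem_cat => /orP[/good_L|/good_Q]; exact: cell_lt.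
Qed.

(* The middle cell c2 is given up: it only provides a gap of positive width between the
   slopes of c1 and c3. *)
Lemma maker_step j h L Q c1 c2 c3 :
  state j h L [:: c1, c2, c3 & Q] -> maker_turn s (size h) ->
  exists2 p, legal_move h p &
    exists d1 d2, state j (rcons h p) (L ++ [:: d1; d2]) Q.
Proof.
case=> origin gp_h good_L good_Q sorted_LQ turn.
have [g1 g2 g3] : [/\ good_cell (placed h) (maker_points s h) j c1,
    good_cell (placed h) (maker_points s h) j c2 &
    good_cell (placed h) (maker_points s h) j c3].
  by split; apply: good_Q; rewrite !inE eqxx ?orbT.
move: sorted_LQ; rewrite pairwise_cat => /and3P[/allrelP LQ sorted_L].
rewrite /= => /andP[/and3P[b12 _ _] /and3P[/andP[b23 _] /allP b3Q sorted_Q]].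
rewrite /before in b12 b23.
have l1 := cell_lt g1; have l2 := cell_lt g2; have l3 := cell_lt g3.
have gap : c1.2.2 < c3.2.1 by apply: le_lt_trans b12 (lt_le_trans l2 b23).
have origin' : 0 \in placed h := fsubsetP (maker_points_sub h) _ origin.
have [t /andP[lt_t t_lt] small_d] := general_position_near origin' gp_h gap.
have small1 := separated_add_near t (cell_sector g1) (cell_origin g1) (cell_separated g1).
have small3 := separated_add_near t (cell_sector g3) (cell_origin g3) (cell_separated g3).
have [e e_gt0 /= [[d_new gp_d] [sep1 sep3]]] :=
  small_ex (small_and small_d (small_and small1 small3)).
rewrite xc0 yc0 !add0r in d_new gp_d.
set d := pt e (e * t) in d_new gp_d sep1 sep3.
have d_new' : d \notin maker_points s h.
  by apply: contra d_new; apply: (fsubsetP (maker_points_sub h)).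
exists d; first by split; [rewrite -mem_placed | rewrite placed_rcons].
have subM : (maker_points s h `<=` maker_points s (rcons h d))%fset.
  by rewrite maker_points_rcons turn fsubsetU1.
(* The new point has slope [t], so it hits no cell whose interval lies on one side of [t], even with
   [t] as an end. *)
have keep j' c : good_cell (placed h) (maker_points s h) j' c ->
    c.2.2 <= t \/ t <= c.2.1 ->
    good_cell (placed (rcons h d)) (maker_points s (rcons h d)) j' c.
  move=> gc out; rewrite placed_rcons.
  apply: good_cell_keep gc subM (maker_points_sub h) d_new gp_d _.
  rewrite /hit /strictly_inside xc_pt yc_pt e_gt0 ![_ * e]mulrC !ltr_pM2l //=.
  by rewrite negb_and -!leNgt orbC; apply/orP.
exists ((d |` c1.1)%fset, (c1.2.1, t)), ((d |` c3.1)%fset, (t, c3.2.2)).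
have L_le c : c \in L -> c.2.2 <= c1.2.1 by move=> cL; apply: LQ; rewrite ?mem_head.
split; rewrite ?placed_rcons //.
- exact: (fsubsetP subM).
- move=> c; rewrite mem_cat => /orP[cL|].
    rewrite -placed_rcons; apply: keep; first exact: good_L.
    by left; apply: le_trans (L_le c cL) (ltW (lt_trans l1 lt_t)).
  rewrite maker_points_rcons turn !inE => /orP[] /eqP->.
    by apply: good_cell_add => //; [apply: lt_trans lt_t | left].
  by apply: good_cell_add => //; [apply: lt_trans l3 | right].
- move=> c cQ; rewrite -placed_rcons; apply: keep.
    by apply: good_Q; rewrite !inE cQ !orbT.
  by right; apply: le_trans (b3Q c cQ); apply/ltW/(lt_trans t_lt).
rewrite -catA pairwise_cat sorted_L /= sorted_Q /before /= lexx /= !andbT.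
have t_le c : c \in Q -> t <= c.2.1.
  by move=> cQ; apply: le_trans (b3Q c cQ); apply/ltW/(lt_trans t_lt).
apply/and3P; split; last 2 first.
- by apply/allP.
- by apply/allP.
apply/allrelP => c c' cL; rewrite !inE => /or3P[/eqP->|/eqP->|cQ] /=.
- exact: L_le.
- by apply: le_trans (L_le c cL) (ltW (lt_trans l1 lt_t)).
- by apply: LQ; rewrite // !inE cQ !orbT.
Qed.

(** * Wins forced within a bounded number of moves of both players, and the induction over stages *)

Fixpoint forces (n : nat) h : Prop :=
  maker_has_won s k h \/
  if n is n'.+1 then
    if maker_turn s (size h)
    then exists2 p, legal_move h p & forces n' (rcons h p)
    else forall p, legal_move h p -> forces n' (rcons h p)
  else False.

Lemma forces_mono n m h : (n <= m)%N -> forces n h -> forces m h.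
Proof.
elim: n m h => [|n IHn] [|m] h //=; first by move=> _ [|[]]; left.
rewrite ltnS => le_nm [|]; first by left.
case: ifP => _ => [[p legal_p /(IHn _ _ le_nm)]|step]; first by right; exists p.
by right=> p /step /(IHn _ _ le_nm).
Qed.

(** The 5 covers all losses: less than 2 for the initial [lead], at most 4/3 for two unprocessed
    cells, at most 1 for the final [lead]. The duration [n] may depend on [t], but the family sizes
    may not. *)
Lemma stage j N N' :
  N'%:R + 5 <= (2 - s) / 3 * N%:R ->
  (forall t, exists n, forall h Q,
     (size h <= t)%N -> state j.+1 h [::] Q -> size Q = N' -> forces n h) ->
  forall t, exists n, forall h Q,
     (size h <= t)%N -> state j h [::] Q -> size Q = N -> forces n h.
Proof.
(* [n1] bounds the length of the stage: the number of Maker's moves plus [size Q] never increases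
   and is at most [t + N] at the start. *)
move=> enough next t; set n1 := (3 * (t + N) + 2)%N.
have [n2 win2] := next (t + n1)%N.
set c := (2 - s) / 3 in enough; have [c_gt0 c_le cE] : [/\ 0 < c, c <= 2 / 3 & 3 * c = 2 - s].
  by move: s_ge0 s_lt2; rewrite /c; split; lra.
have finish h L Q : (size Q <= 2)%N -> (size h <= t + n1)%N ->
    c * N%:R - s <= (size L)%:R + c * (size Q)%:R + lead s (size h) ->
    state j h L Q -> forces n2 h.
  move=> le_Q2 le_h pot [origin gp_h good_L _]; rewrite pairwise_cat => /and3P[_ sorted_L _].
  have le_N' : (N' <= size L)%N.
    rewrite -(ler_nat R); have /andP[_] := lead_bounds s_ge0 (size h).
    have : (size Q)%:R <= 2%:R :> R by rewrite ler_nat.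
    by move: s_ge0 s_lt2; nra.
  (* The rest of [L] and all of [Q] are dropped, and the first [N'] new holes start the next
     stage. *)
  apply: (win2 h (take N' L)) => //; last by rewrite size_take_min (minn_idPl le_N').
  split=> // [x /mem_take /good_L //|].
  by move: sorted_L; rewrite -{1}(cat_take_drop N' L) pairwise_cat => /and3P[].
(* The potential [size L + c * size Q + lead] never decreases: a move of Maker adds
   [2 - 3 c - s = 0] to it, a move of Breaker at least [1 - 1 = 0]. *)
suff stage_n n h L Q :
    (3 * ((move_counts s (size h)).1 + size Q) + 2 <= size h + n)%N ->
    (size h + n <= t + n1)%N ->
    c * N%:R - s <= (size L)%:R + c * (size Q)%:R + lead s (size h) ->
    state j h L Q -> forces (n + n2) h.
  exists (n1 + n2)%N => h Q le_t st sizeQ; apply: (stage_n _ _ [::] Q) => //.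
  - have := move_counts_add s (size h); rewrite sizeQ /n1; lia.
  - lia.
  - by have /andP[] := lead_bounds s_ge0 (size h); rewrite sizeQ /=; move: s_lt2; lra.
elim: n h L Q => [|n IHn] h L Q fuel bound pot st.
  (* With no fuel left, the history would be longer than [moves_le] permits. *)
  by have := moves_le s_ge0 s_lt2 (size h); lia.
have [le_Q2|] := leqP (size Q) 2.
  apply: (forces_mono (leq_addl _ _)); apply: finish le_Q2 _ pot st.
  exact: leq_trans (leq_addr _ _) bound.
case: Q fuel bound pot st => [|c1 [|c2 [|c3 Q]]] //= fuel bound pot st _; right.
have [turn|turn] := boolP (maker_turn s (size h)).
  have [m_eq lead_eq] := move_counts_maker turn.
  have [p legal_p [d1 [d2 st']]] := maker_step st turn.
  exists p => //; apply: IHn st'; rewrite size_rcons ?m_eq ?lead_eq; try lia.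
  rewrite size_cat natrD /=; move: pot; rewrite -[_.+3]addn3 natrD; lra.
have [m_eq lead_eq] := move_counts_breaker turn.
move=> p /(breaker_step st)[L' [Q' [st' leL leQ le_LQ]]].
apply: IHn st'; rewrite size_rcons ?m_eq ?lead_eq /= in leQ le_LQ *; try lia.
move: leL leQ le_LQ pot; rewrite -!(ler_nat R) -natr1 !natrD => leL leQ le_LQ pot.
nra.
Qed.


Lemma good_cell_hole h c :
  good_cell (placed h) (maker_points s h) k c -> maker_has_won s k h.
Proof.
case=> subM cardc _ _ _ sep_c; exists c.1; split=> //.
by apply: separated_hole => //; apply: fsubset_trans subM (maker_points_sub h).
Qed.

(** Induction on the number [r] of stages left; at level [k] a single cell is already a win. *)
Lemma forces_from_level r j :
  (j + r = k)%N ->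
  exists N, forall t, exists n, forall h Q,
    (size h <= t)%N -> state j h [::] Q -> size Q = N -> forces n h.
Proof.
elim: r j => [|r IHr] j def_k.
  exists 1%N => t; exists 0%N => h [|c []] //= _ [_ _ _ good_Q _] _; left.
  by apply: (@good_cell_hole _ c); rewrite -def_k addn0; apply/good_Q/mem_head.
have [|N' next] := IHr j.+1; first by rewrite addSnnS.
have c_gt0 : 0 < (2 - s) / 3 by rewrite divr_gt0 ?subr_gt0.
exists (Num.bound ((N'%:R + 5) / ((2 - s) / 3))).
apply: stage next; rewrite mulrC -ler_pdivrMr //.
by apply/ltW/archi_boundP; rewrite divr_ge0 ?addr_ge0 // ltW.
Qed.

Lemma forces_start : (0 < k)%N -> exists n, forces n [::].
Proof.
move=> k_gt0; have [|N /(_ 1%N)[n win]] := @forces_from_level k.-1 1; first by rewrite add1n prednK.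
have turn0 : maker_turn s 0 by rewrite /maker_turn /maker_next mul0r.
exists n.+1; right; rewrite /= turn0; exists 0.
  by split=> // p q r; rewrite !inE !orbF => /eqP-> /eqP->; rewrite eqxx.
(* All [N] cells consist of the origin alone and differ only in their slope intervals. *)
pose fan : seq (cell R) := [seq ([fset (0 : plane R)]%fset, (i%:R, i.+1%:R)) | i <- iota 0 N].
apply: (win _ fan); rewrite ?size_map ?size_iota //.
have maker0 : maker_points s [:: 0] = [fset 0]%fset.
  by rewrite -[[:: 0]]/(rcons [::] 0) maker_points_rcons turn0; apply/fsetP => p; rewrite !inE orbF.
have placed0 : placed [:: 0 : plane R] = [fset 0]%fset by apply/fsetP => p; rewrite !inE orbF.
split=> //; rewrite ?maker0 ?placed0 ?inE //.
- by move=> p q r; rewrite !inE => /eqP-> /eqP->; rewrite eqxx.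
- move=> c /mapP[i _ ->]; split=> //=; rewrite ?cardfs1 ?inE ?ltr_nat //.
  + by move=> h; rewrite inE => /eqP->; rewrite eqxx.
  + by move=> p; rewrite inE => /eqP->; exists 0, 0 => h; rewrite inE => /eqP->; rewrite eqxx.
- rewrite /= pairwise_map; apply: sub_pairwise (_ : pairwise ltn _).
    by move=> i i' /=; rewrite /before /= ler_nat.
  by rewrite -sorted_pairwise ?iota_ltn_sorted //; apply: ltn_trans.
Qed.

(** * From a bounded forced win to a winning strategy *)

Lemma consistent_take sigma h i : consistent s sigma h -> consistent s sigma (take i h).
Proof.
move=> cons_h j; rewrite size_take_min leq_min => /andP[lt_ji lt_jh].
have := cons_h j lt_jh; rewrite nth_take // take_takel // ltnW //.
Qed.

Lemma consistent_general_position sigma h :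
  (forall g, general_position (placed g) -> maker_turn s (size g) -> legal_move g (sigma g)) ->
  consistent s sigma h -> general_position (placed h).
Proof.
move=> legal_sigma; elim/last_ind: h => [|h p IHh] cons_h; first by move=> p q r; rewrite inE.
have gp_h : general_position (placed h).
  by apply: IHh; have := consistent_take (i := size h) cons_h; rewrite -cats1 take_size_cat.
have := cons_h (size h); rewrite size_rcons ltnSn nth_rcons ltnn eqxx => /(_ isT).
rewrite -cats1 take_size_cat // cats1.
by case: ifP => [turn ->|_ []] //; case: (legal_sigma h gp_h turn).
Qed.

(** Where a win is still forced within [n - size h] moves, the strategy picks a legal move
    preserving this; in other positions, any legal move. A play without a win would reach bound 0
    after [n] moves, where [forces] itself means a win. *)
Lemma forces_winning n : forces n [::] -> exists sigma, winning_strategy s k sigma.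
Proof.
move=> win0.
pose reply h p := general_position (placed h) -> maker_turn s (size h) ->
  legal_move h p /\ (forces (n - size h) h -> ~ maker_has_won s k h ->
                      forces (n - (size h).+1) (rcons h p)).
have [h|sigma sigmaP] := @choice _ _ reply.
  have [[gp_h turn]|not_turn] :=
    pselect (general_position (placed h) /\ maker_turn s (size h)); last first.
    by exists 0 => gp_h turn; case: not_turn.
  have [[win not_won]|no_win] := pselect (forces (n - size h) h /\ ~ maker_has_won s k h).
    (* If the truncated difference is 0, [forces] says that Maker has already won, contrary to
       [not_won]. *)
    move: win; rewrite /reply subnS; case: (n - size h)%N => [|m] /=; case=> //.
    by rewrite turn => -[p legal_p win_p]; exists p.
  have [p legal_p] := legal_move_exists gp_h.
  by exists p => _ _; split=> // win not_won; case: no_win.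
have sigma_legal h gp_h turn := (sigmaP h gp_h turn).1.
exists sigma; split.
  by move=> h cons_h turn; exact: sigma_legal (consistent_general_position sigma_legal cons_h) turn.
move=> x cons_x; apply: contrapT => /forallNP not_won.
have win m : forces (n - m) (mkseq x m).
  elim: m => [|m IHm]; first by rewrite subn0.
  have gp_m := consistent_general_position sigma_legal (cons_x m).
  have := cons_x m.+1 m; rewrite size_mkseq ltnSn nth_mkseq // => /(_ isT).
  rewrite mkseqS -cats1 take_size_cat ?size_mkseq // cats1.
  case: ifP => [turn ->|turn legal_x].
    have := sigmaP _ gp_m; rewrite size_mkseq => /(_ turn)[_]; apply => //; exact: not_won.
  move: IHm; rewrite subnS; case: (n - m)%N => [|d] /=; case=> [/not_won //|] //.
  by rewrite size_mkseq turn; apply.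
have := win n; rewrite subnn => -[/not_won|] //.
Qed.

End Game.

Theorem theorem5 (R : realType) (s : R) (k : nat) :
  0 <= s -> s < 2 -> (3 <= k)%N ->
  exists sigma : strategy R, winning_strategy s k sigma.
Proof.
move=> s_ge0 s_lt2 k_ge3.
have [n win] := forces_start s_ge0 s_lt2 (ltnW (ltnW k_ge3)).
exact: forces_winning win.
Qed.
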